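(* Let $n\ge1$ be an integer, let $f_n(x)=\sqrt{\frac{\pi}{2}}\,x^{n+\frac12}J_{n+\frac12}(x)$ for $x>0$, and let $V(f_n)$ be the function on $(0,\infty)$ given by $$V(f_n)=\left(\frac12\left(p'p-p''\right)f_n+p'f_n'\right)f_n'-\left(\frac12p^2-p'-2q+\frac{p'''}{p'}-\frac32\frac{(p'')^2}{(p')^2}\right)v(f_n)$$ with $p(x)=-\frac{2n}{x}$, $q=1$ and $v(f_n)=(f_n')^2-f_n''f_n$. Then $V(f_n)$ is positive on $(0,\infty)$, and the functions $x\mapsto x^{-2n}V(f_n)(x)$ and $x\mapsto V(f_n)(x)$ are increasing and positive on $(0,j'_{n+\frac12,1})$.
   Context: $J_\nu$ denotes the Bessel function of the first kind, $J_\nu(x)=\sum_{k=0}^\infty \frac{(-1)^k}{\Gamma(k+1)\Gamma(k+\nu+1)}\left(\frac{x}{2}\right)^{2k+\nu}$, and $j'_{\nu,1}$ denotes the first positive zero of the derivative $J_\nu'$. The function $f_n$ satisfies $f_n''+pf_n'+qf_n=0$ with $p(x)=-\frac{2n}{x}$ and $q=1$. Here ''increasing'' is understood in the weak sense: $g(x)\le g(y)$ whenever $x<y$. *)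

(* Defs.v *)
From Stdlib Require Import Reals.
From Coquelicot Require Import Coquelicot.
Open Scope R_scope.

(* Euler's integral: the Gamma function for positive arguments only.  [RInt_gen]
   has no specified value where the integral diverges, that is for s <= 0. *)
Definition Gamma (s : R) : R :=
  RInt_gen (fun t => Rpower t (s - 1) * exp (- t)) (at_right 0) (Rbar_locally p_infty).

(* Meaningful for nu > -1, so that all Gamma arguments are positive, and for
   x > 0, the domain on which [Rpower] is the real power function. *)
Definition bessel_J (nu x : R) : R :=
  Series (fun k : nat =>
    (-1) ^ k / (Gamma (INR k + 1) * Gamma (INR k + nu + 1))
      * Rpower (x / 2) (2 * INR k + nu)).

Definition is_first_positive_zero (g : R -> R) (j : R) : Prop :=
  0 < j /\ g j = 0 /\ (forall x, 0 < x < j -> g x <> 0).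

Definition f_ (n : nat) (x : R) : R :=
  sqrt (PI / 2) * Rpower x (INR n + 1 / 2) * bessel_J (INR n + 1 / 2) x.

Definition p_ (n : nat) (x : R) : R := - (2 * INR n) / x.

Definition q_ (x : R) : R := 1.

Definition v (f : R -> R) (x : R) : R :=
  Derive f x ^ 2 - Derive_n f 2 x * f x.

Definition V (p q f : R -> R) (x : R) : R :=
  (1 / 2 * (Derive p x * p x - Derive_n p 2 x) * f x + Derive p x * Derive f x)
    * Derive f x
  - (1 / 2 * p x ^ 2 - Derive p x - 2 * q x
     + Derive_n p 3 x / Derive p x
     - 3 / 2 * (Derive_n p 2 x ^ 2 / Derive p x ^ 2)) * v f x.

(* Weak monotonicity. *)
Definition increasing_on (a b : R) (g : R -> R) : Prop :=
  forall x y, a < x -> x < y -> y < b -> g x <= g y.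

Definition positive_on (a b : R) (g : R -> R) : Prop :=
  forall x, a < x < b -> 0 < g x.

(* Main.v *)
(* Up to positive constants, f_n = x^n u and f_n' = x^n b with u = x j_n and
   b = x j_(n-1) (spherical Bessel functions), where u' = b - (n/x) u and
   b' = (n/x) b - u.  Substituting, x^(-2n) V(f_n) is a positive multiple of an
   explicit quadratic form W in (u, b), and
     W' = 3 n (n-1) x^(-3) T,   T = b^2 + u^2 - ((2n-1)/x) u b,   (x T)' = 2 b^2.
   The power series give x T ~ c x^(2n+1) and W ~ c' x^(2n-2) at 0 with c, c' > 0,
   so T > 0 and then W is nondecreasing and positive, on all of (0, oo).  The
   value of Gamma(1/2) is irrelevant: only positivity of Gamma and its functional
   equation enter. *)
Require Import Defs.
From Stdlib Require Import Reals Lra Lia Classical.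
From Coquelicot Require Import Coquelicot.
Open Scope R_scope.

(** * The Gamma function *)

(** For a positive integrand the integral grows with the interval, so bounded integrals converge to
    their supremum [l]. This limit is positive because it dominates the integral over [1, 2]. *)
Lemma is_RInt_gen_bounded_nonneg (h : R -> R) (M : R) :
  (forall t, 0 < t -> continuous h t) ->
  (forall t, 0 < t -> 0 < h t) ->
  (forall a b, 0 < a < b -> RInt h a b <= M) ->
  exists l, 0 < l /\ is_RInt_gen h (at_right 0) (Rbar_locally p_infty) l.
Proof.
intros hc hp hM.
assert (hex : forall a b, 0 < a -> 0 < b -> ex_RInt h a b).
{ intros a b ha hb. apply (@ex_RInt_continuous R_CompleteNormedModule).
  intros z hz. apply hc. apply Rlt_le_trans with (2 := proj1 hz).
  now apply Rmin_glb_lt. }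
assert (hnn : forall a b, 0 < a <= b -> 0 <= RInt h a b).
{ intros a b hab. apply RInt_ge_0; [lra | apply hex; lra |].
  intros x hx. apply Rlt_le, hp. lra. }
assert (hch : forall a b c, 0 < a -> 0 < b -> 0 < c ->
  RInt h a c = RInt h a b + RInt h b c).
{ intros a b c ha hb hc'. symmetry.
  apply (@RInt_Chasles R_CompleteNormedModule h a b c); now apply hex. }
destruct (completeness (fun r => exists a b, 0 < a < b /\ r = RInt h a b))
  as [l [hub hlub]].
{ exists M. intros r (a & b & hab & ->). now apply hM. }
{ exists (RInt h 1 2), 1, 2. split; [lra | easy]. }
exists l. split.
{ apply Rlt_le_trans with (RInt h 1 2).
  - apply RInt_gt_0; [lra | |]; intros x hx; [apply hp | apply hc]; lra.
  - apply hub. exists 1, 2. split; [lra | easy]. }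
intros P [eps hP].
destruct (classic (exists a b, 0 < a < b /\ l - eps < RInt h a b))
  as [(a0 & b0 & hab & hl) | hno].
2:{ exfalso. assert (l <= l - eps); [| pose proof (cond_pos eps); lra].
    apply hlub. intros r (a & b & hab & ->).
    apply Rnot_lt_le. intros hlt. apply hno. now exists a, b. }
(* Every interval containing [a0, b0] has its integral between [l - eps] and [l]. *)
apply (Filter_prod _ _ _ (fun a => 0 < a < a0) (fun b => b0 < b)).
- exists (mkposreal a0 (proj1 hab)). intros y hy hy0. split; [easy |].
  unfold ball in hy. simpl in hy. unfold AbsRing_ball, abs, minus, plus, opp in hy.
  simpl in hy. apply Rabs_def2 in hy. lra.
- now exists b0.
- intros a b ha hb. simpl.
  exists (RInt h a b). split.
  + apply (@RInt_correct R_CompleteNormedModule). apply hex; lra.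
  + apply hP. unfold ball. simpl. unfold AbsRing_ball, abs, minus, plus, opp. simpl.
    assert (RInt h a b <= l) by (apply hub; exists a, b; split; [lra | easy]).
    rewrite (hch a a0 b) in * by lra. rewrite (hch a0 b0 b) in * by lra.
    pose proof (hnn a a0 ltac:(lra)). pose proof (hnn b0 b ltac:(lra)).
    apply Rabs_def1; pose proof (cond_pos eps); lra.
Qed.

Lemma exp_le_exp (x y : R) : x <= y -> exp x <= exp y.
Proof. intros [h | ->]; [now apply Rlt_le, exp_increasing | apply Rle_refl]. Qed.

Lemma Rpower_pos (x y : R) : 0 < Rpower x y.
Proof. apply exp_pos. Qed.

Lemma is_derive_Rpower (s x : R) :
  0 < x -> is_derive (fun t => Rpower t s) x (s * Rpower x s / x).
Proof.
intros hx. unfold Rpower. auto_derive; [lra | field; lra].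
Qed.

Lemma continuous_Rpower (s x : R) : 0 < x -> continuous (fun t => Rpower t s) x.
Proof.
intros hx. apply (@ex_derive_continuous R_AbsRing R_NormedModule).
eexists. now apply is_derive_Rpower.
Qed.

Lemma Rpower_pred (x s : R) : 0 < x -> Rpower x (s - 1) = Rpower x s / x.
Proof.
intros hx. unfold Rminus. rewrite Rpower_plus, Rpower_Ropp, Rpower_1; easy.
Qed.

Lemma ln_le_pred (x : R) : 0 < x -> ln x <= x - 1.
Proof. intros hx. pose proof (exp_ineq1_le (ln x)). rewrite exp_ln in H; lra. Qed.

(* From [ln z <= z - 1] at [z = t / (2 s)]. *)
Lemma Rpower_exp_bound (s t : R) : 0 < s -> 0 < t ->
  Rpower t s * exp (- t) <= exp (s * ln (2 * s) - s) * exp (- t / 2).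
Proof.
intros hs ht. unfold Rpower. rewrite <- !exp_plus.
apply exp_le_exp.
assert (ht2 : 0 < t / (2 * s)) by (apply Rdiv_lt_0_compat; lra).
replace t with (t / (2 * s) * (2 * s)) at 1 by (field; lra).
rewrite ln_mult by lra.
pose proof (Rmult_le_compat_l s _ _ (Rlt_le _ _ hs) (ln_le_pred _ ht2)) as H.
replace (s * (t / (2 * s) - 1)) with (t / 2 - s) in H by (field; lra).
lra.
Qed.

Lemma continuous_gamma_integrand (s t : R) :
  0 < t -> continuous (fun t => Rpower t s * exp (- t)) t.
Proof.
intros ht. apply (@continuous_mult R_UniformSpace R_AbsRing).
- now apply continuous_Rpower.
- apply (@ex_derive_continuous R_AbsRing R_NormedModule). now auto_derive.
Qed.

Lemma is_derive_gamma_boundary (s t : R) : 0 < t ->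
  is_derive (fun t => Rpower t s * exp (- t)) t
    (s * (Rpower t (s - 1) * exp (- t)) - Rpower t s * exp (- t)).
Proof.
intros ht. rewrite Rpower_pred by easy.
unfold Rpower. auto_derive; [lra | field; lra].
Qed.

(** The majorant [K * exp (- t / 2)] from [Rpower_exp_bound] has integral [2 * K] over the
    half-line. *)
Lemma RInt_gamma_bounded (s : R) : 0 < s ->
  exists M, forall a b, 0 < a < b -> RInt (fun t => Rpower t s * exp (- t)) a b <= M.
Proof.
intros hs. set (K := exp (s * ln (2 * s) - s)).
exists (K * 2). intros a b hab.
assert (hK : is_RInt (fun t => K * exp (- t / 2)) a b
   (minus (- 2 * K * exp (- b / 2)) (- 2 * K * exp (- a / 2)))).
{ apply (@is_RInt_derive R_CompleteNormedModule (fun t => - 2 * K * exp (- t / 2))).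
  - intros x _. auto_derive; [easy | unfold Rdiv; field].
  - intros x _. apply (@ex_derive_continuous R_AbsRing R_NormedModule). now auto_derive. }
apply Rle_trans with (RInt (fun t => K * exp (- t / 2)) a b).
- apply RInt_le; [lra | | now eexists; apply hK |].
  + apply (@ex_RInt_continuous R_CompleteNormedModule). intros z hz.
    rewrite Rmin_left in hz by lra. apply continuous_gamma_integrand. lra.
  + intros x hx. apply Rpower_exp_bound; lra.
- rewrite (is_RInt_unique _ _ _ _ hK). unfold minus, plus, opp; simpl.
  assert (hKp : 0 < K) by apply exp_pos.
  pose proof (Rmult_lt_0_compat _ _ hKp (exp_pos (- b / 2))).
  assert (exp (- a / 2) <= 1) by (rewrite <- exp_0; apply exp_le_exp; lra).
  pose proof (Rmult_le_compat_l K _ _ (Rlt_le _ _ hKp) H0).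
  lra.
Qed.

Lemma filterlim_gamma_boundary_0 (s : R) : 0 < s ->
  filterlim (fun t => Rpower t s * exp (- t)) (at_right 0) (locally 0).
Proof.
intros hs. apply filterlim_locally. intros eps.
(* The radius eps^(1/s) is the point where t^s reaches eps; the exponential factor is at most 1. *)
exists (mkposreal _ (Rpower_pos eps (/ s))). intros t ht ht0.
unfold ball in *. simpl in *. unfold AbsRing_ball, abs, minus, plus, opp in *. simpl in *.
apply Rabs_def2 in ht. rewrite Ropp_0, Rplus_0_r in *.
assert (h1 : Rpower t s < eps).
{ replace (pos eps) with (Rpower (Rpower eps (/ s)) s).
  - unfold Rpower at 1 2. apply exp_increasing, Rmult_lt_compat_l; [easy |].
    apply ln_increasing; lra.
  - rewrite Rpower_mult, Rinv_l, Rpower_1; [easy | apply cond_pos | lra]. }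
assert (exp (- t) <= 1) by (rewrite <- exp_0; apply exp_le_exp; lra).
pose proof (Rpower_pos t s). pose proof (exp_pos (- t)).
apply Rabs_def1; nra.
Qed.

Lemma filterlim_gamma_boundary_infty (s : R) : 0 < s ->
  filterlim (fun t => Rpower t s * exp (- t)) (Rbar_locally p_infty) (locally 0).
Proof.
intros hs. apply filterlim_locally. intros eps.
set (K := exp (s * ln (2 * s) - s)).
assert (hK : 0 < K) by apply exp_pos.
(* The threshold solves K exp(-t/2) = eps; the maximum with 0 keeps t positive. *)
exists (Rmax 0 (- 2 * ln (eps / K))). intros t ht.
unfold ball in *. simpl in *. unfold AbsRing_ball, abs, minus, plus, opp in *. simpl in *.
rewrite Ropp_0, Rplus_0_r.
pose proof (Rmax_l 0 (- 2 * ln (eps / K))). pose proof (Rmax_r 0 (- 2 * ln (eps / K))).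
pose proof (Rpower_exp_bound s t hs ltac:(lra)) as hb. fold K in hb.
assert (he : exp (- t / 2) < eps / K).
{ rewrite <- (exp_ln (eps / K)) by (apply Rdiv_lt_0_compat; [apply cond_pos | easy]).
  apply exp_increasing. lra. }
apply (Rmult_lt_compat_l K) in he; [| easy].
replace (K * (eps / K)) with (pos eps) in he by (field; lra).
pose proof (Rmult_lt_0_compat _ _ (Rpower_pos t s) (exp_pos (- t))).
apply Rabs_def1; lra.
Qed.

(** [RInt_gen] is a total function, so convergence has to be established before the value of [Gamma]
    means anything. For s < 1 the integrand is unbounded at 0, hence the detour through the exponent
    s. *)
Lemma Gamma_correct (s : R) : 0 < s ->
  0 < Gamma s /\
  is_RInt_gen (fun t => Rpower t (s - 1) * exp (- t))
    (at_right 0) (Rbar_locally p_infty) (Gamma s).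
Proof.
intros hs. destruct (RInt_gamma_bounded s hs) as [M hM].
set (K := exp (s * ln (2 * s) - s)).
(* [K] bounds the boundary term at b, and [M] bounds the integral with exponent s. *)
destruct (is_RInt_gen_bounded_nonneg (fun t => Rpower t (s - 1) * exp (- t)) ((K + M) / s))
  as [l [hl hi]].
- intros t ht. now apply continuous_gamma_integrand.
- intros t ht. apply Rmult_lt_0_compat; apply exp_pos.
- (* Integration by parts reduces to the exponent [s > 0]. *)
  intros a b hab.
  assert (hpos : forall t, Rmin a b <= t <= Rmax a b -> 0 < t).
  { intros t ht. rewrite Rmin_left in ht; lra. }
  assert (hd := is_RInt_derive (fun t => Rpower t s * exp (- t)) _ a b
    (fun x hx => is_derive_gamma_boundary s x (hpos x hx))
    (fun x hx => continuous_minus _ _ x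
      (continuous_scal_r s _ x (continuous_gamma_integrand (s - 1) x (hpos x hx)))
      (continuous_gamma_integrand s x (hpos x hx)))).
  assert (hI : forall r, ex_RInt (fun t => Rpower t r * exp (- t)) a b).
  { intros r. apply (@ex_RInt_continuous R_CompleteNormedModule). intros z hz.
    now apply continuous_gamma_integrand, hpos. }
  assert (hd' := is_RInt_minus _ _ _ _ _ _
    (is_RInt_scal _ _ _ s _ (RInt_correct _ _ _ (hI (s - 1))))
    (RInt_correct _ _ _ (hI s))).
  apply is_RInt_unique in hd. apply is_RInt_unique in hd'.
  unfold scal, minus, plus, opp in hd, hd'. simpl in hd, hd'.
  unfold mult in hd, hd'. simpl in hd, hd'.
  assert (e : s * RInt (fun t => Rpower t (s - 1) * exp (- t)) a b
     = RInt (fun t => Rpower t s * exp (- t)) a b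
       + Rpower b s * exp (- b) - Rpower a s * exp (- a)).
  { unfold Rminus in hd, hd' |- *. rewrite hd in hd'. lra. }
  pose proof (hM a b hab).
  pose proof (Rpower_exp_bound s b hs ltac:(lra)) as hb. fold K in hb.
  pose proof (Rmult_lt_0_compat _ _ (Rpower_pos a s) (exp_pos (- a))).
  assert (exp (- b / 2) <= 1) by (rewrite <- exp_0; apply exp_le_exp; lra).
  assert (0 < K) by apply exp_pos.
  apply Rmult_le_reg_l with s; [easy |].
  replace (s * ((K + M) / s)) with (K + M) by (field; lra). nra.
- unfold Gamma. rewrite (is_RInt_gen_unique _ _ hi). now split.
Qed.

Lemma Gamma_pos (s : R) : 0 < s -> 0 < Gamma s.
Proof. intros hs. now apply Gamma_correct. Qed.

(** The boundary function t^s exp(-t) tends to 0 at both ends, so its derivative s t^(s-1) exp(-t) -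
    t^s exp(-t) has integral 0 over the half-line. *)
Lemma Gamma_S (s : R) : 0 < s -> Gamma (s + 1) = s * Gamma s.
Proof.
intros hs. unfold Gamma at 1.
apply (is_RInt_gen_unique (V := R_CompleteNormedModule)).
replace (s + 1 - 1) with s by ring.
set (F := fun t => Rpower t s * exp (- t)).
(* Eventually both endpoints are positive, so the whole segment lies where [Rpower] is the real
   power. *)
assert (hpos : filter_prod (at_right 0) (Rbar_locally p_infty)
  (fun ab : R * R => forall x, Rmin (fst ab) (snd ab) <= x <= Rmax (fst ab) (snd ab) -> 0 < x)).
{ apply (Filter_prod _ _ _ (fun a => 0 < a) (fun b => 0 < b)).
  - now exists (mkposreal 1 Rlt_0_1).
  - now exists 0.
  - intros a b ha hb x hx. simpl in hx. apply Rlt_le_trans with (2 := proj1 hx).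
    now apply Rmin_glb_lt. }
assert (hD : forall x, 0 < x -> Derive F x =
    s * (Rpower x (s - 1) * exp (- x)) - Rpower x s * exp (- x)).
{ intros x hx. apply is_derive_unique. now apply is_derive_gamma_boundary. }
assert (h0 : is_RInt_gen (Derive F) (at_right 0) (Rbar_locally p_infty) (0 - 0)).
{ apply is_RInt_gen_Derive.
  - eapply filter_imp; [| exact hpos]. intros [a b] h x hx.
    eexists. apply is_derive_gamma_boundary. now apply h.
  - eapply filter_imp; [| exact hpos]. intros [a b] h x hx.
    specialize (h x hx).
    apply (continuous_ext_loc _
      (fun x => s * (Rpower x (s - 1) * exp (- x)) - Rpower x s * exp (- x))).
    + exists (mkposreal x h). intros y hy.
      unfold ball in hy; simpl in hy; unfold AbsRing_ball, abs, minus, plus, opp in hy; simpl in hy.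
      apply Rabs_def2 in hy. symmetry. apply hD. lra.
    + apply (@continuous_minus R_UniformSpace R_AbsRing R_NormedModule).
      * apply (@continuous_scal_r R_UniformSpace R_AbsRing R_NormedModule s).
        now apply continuous_gamma_integrand.
      * now apply continuous_gamma_integrand.
  - now apply filterlim_gamma_boundary_0.
  - now apply filterlim_gamma_boundary_infty. }
assert (hs1 := is_RInt_gen_scal _ s _ (proj2 (Gamma_correct s hs))).
assert (hm := is_RInt_gen_minus _ _ _ _ hs1 h0).
replace (s * Gamma s) with (minus (scal s (Gamma s)) (0 - 0))
  by (unfold minus, plus, opp, scal, mult; simpl; unfold mult; simpl; ring).
refine (is_RInt_gen_ext _ _ _ _ hm).
eapply filter_imp; [| exact hpos]. intros [a b] h x hx.
rewrite hD by (apply h; split; apply Rlt_le; apply hx).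
unfold F, minus, plus, opp, scal, mult; simpl; unfold mult; simpl; ring.
Qed.

(** * Real functions on the positive half-line *)

Lemma locally_Rlt (x : R) : 0 < x -> locally x (fun t => 0 < t).
Proof. intros hx. now apply (open_gt 0). Qed.

Lemma nondecreasing_of_derive_nonneg (h dh : R -> R) :
  (forall x, 0 < x -> is_derive h x (dh x)) ->
  (forall x, 0 < x -> 0 <= dh x) ->
  forall x y, 0 < x -> x <= y -> h x <= h y.
Proof.
intros hd hn x y hx hxy.
destruct (MVT_gen h x y dh) as [c [hc e]]; rewrite ?Rmin_left, ?Rmax_right in * by lra.
- intros t ht. apply hd. lra.
- intros t ht. apply continuity_pt_filterlim, (@ex_derive_continuous R_AbsRing R_NormedModule).
  eexists. apply hd. lra.
- assert (0 <= dh c) by (apply hn; lra). nra.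
Qed.

Lemma pos_near_0 (C : R -> R) : continuous C 0 -> 0 < C 0 ->
  exists d, 0 < d /\ forall x, 0 < x < d -> 0 < C x.
Proof.
intros hc h0. destruct (hc _ (open_gt 0 (C 0) h0)) as [d hd].
exists d. split; [apply cond_pos |]. intros x hx. apply hd.
unfold ball; simpl; unfold AbsRing_ball, abs, minus, plus, opp; simpl.
apply Rabs_def1; lra.
Qed.

(** The sign near 0 replaces an initial value, since the formulas it is applied to break down at 0
    itself. *)
Lemma pos_of_pos_near_0 (h dh : R -> R) (d : R) : 0 < d ->
  (forall x, 0 < x < d -> 0 < h x) ->
  (forall x, 0 < x -> is_derive h x (dh x)) ->
  (forall x, 0 < x -> 0 <= dh x) ->
  forall x, 0 < x -> 0 < h x.
Proof.
intros hd0 hp hd hn x hx.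
pose proof (Rmin_l x (d / 2)). pose proof (Rmin_r x (d / 2)).
assert (0 < Rmin x (d / 2)) by (apply Rmin_glb_lt; lra).
apply Rlt_le_trans with (h (Rmin x (d / 2))).
- apply hp. lra.
- now apply (nondecreasing_of_derive_nonneg h dh).
Qed.

(** The zero is the supremum [j] of all t with g > 0 on (0, t). By continuity, g(j) < 0 would give
    negative values just left of [j], and g(j) > 0 would push positivity beyond [j]. *)
Lemma first_positive_zero_exists (g : R -> R) (d x0 : R) :
  (forall x, 0 < x -> continuous g x) ->
  0 < d -> (forall x, 0 < x < d -> 0 < g x) ->
  0 < x0 -> g x0 <= 0 ->
  exists j, is_first_positive_zero g j.
Proof.
intros hc hd hp hx0 hg.
destruct (completeness (fun t => forall s, 0 < s < t -> 0 < g s)) as [j [hub hlub]].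
{ exists x0. intros t ht. apply Rnot_lt_le. intros hlt.
  specialize (ht x0 ltac:(lra)). lra. }
{ now exists d. }
assert (hj : d <= j) by now apply hub.
assert (hpj : forall s, 0 < s < j -> 0 < g s).
{ intros s hs. apply Rnot_le_lt. intros hle.
  assert (j <= s); [| lra].
  apply hlub. intros t ht. apply Rnot_lt_le. intros hlt.
  specialize (ht s ltac:(lra)). lra. }
exists j. split; [lra |]. split.
- destruct (Rtotal_order (g j) 0) as [hlt | [e | hgt]]; [exfalso | easy | exfalso].
  + destruct (hc j ltac:(lra) _ (open_lt 0 (g j) hlt)) as [eps he].
    pose proof (cond_pos eps).
    pose proof (Rmin_l (eps / 2) (j / 2)). pose proof (Rmin_r (eps / 2) (j / 2)).
    assert (0 < Rmin (eps / 2) (j / 2)) by (apply Rmin_glb_lt; lra).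
    (* The bound j/2 keeps [s] positive. *)
    set (s := j - Rmin (eps / 2) (j / 2)).
    assert (g s < 0).
    { apply he. unfold ball; simpl; unfold AbsRing_ball, abs, minus, plus, opp; simpl.
      apply Rabs_def1; unfold s; lra. }
    pose proof (hpj s ltac:(unfold s; lra)). lra.
  + destruct (hc j ltac:(lra) _ (open_gt 0 (g j) hgt)) as [eps he].
    pose proof (cond_pos eps).
    assert (j + eps / 2 <= j); [| lra].
    apply hub. intros s hs.
    destruct (Rlt_le_dec s j) as [h1 | h1]; [apply hpj; lra |].
    apply he. unfold ball; simpl; unfold AbsRing_ball, abs, minus, plus, opp; simpl.
    apply Rabs_def1; lra.
- intros x hx. pose proof (hpj x hx). lra.
Qed.

(** * The power series of the Bessel function *)

(** Coefficients in the variable y = x^2, with 4^k coming from (x/2)^(2k). Splitting off (x/2)^nu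
    leaves a power series with integer exponents, entire in y. *)
Definition bessel_coef (nu : R) (k : nat) : R :=
  (-1) ^ k / (Gamma (INR k + 1) * Gamma (INR k + nu + 1)) / 4 ^ k.

Lemma bessel_coef_neq_0 (nu : R) (k : nat) : -1 < nu -> bessel_coef nu k <> 0.
Proof.
intros hnu. pose proof (pos_INR k).
pose proof (Gamma_pos (INR k + 1) ltac:(lra)).
pose proof (Gamma_pos (INR k + nu + 1) ltac:(lra)).
unfold bessel_coef, Rdiv. repeat apply Rmult_integral_contrapositive_currified.
- apply pow_nonzero. lra.
- apply Rinv_neq_0_compat. nra.
- apply Rinv_neq_0_compat, pow_nonzero. lra.
Qed.

(** The functional equation of Gamma is applied to both factors. This ratio yields both the infinite
    radius of convergence and the differential equation. *)
Lemma bessel_coef_S (nu : R) (k : nat) : -1 < nu ->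
  bessel_coef nu (S k) = - bessel_coef nu k / (4 * (INR k + 1) * (INR k + nu + 1)).
Proof.
intros hnu. pose proof (pos_INR k).
pose proof (Gamma_pos (INR k + 1) ltac:(lra)).
pose proof (Gamma_pos (INR k + nu + 1) ltac:(lra)).
unfold bessel_coef. rewrite S_INR.
replace (INR k + 1 + nu + 1) with (INR k + nu + 1 + 1) by ring.
rewrite (Gamma_S (INR k + 1)), (Gamma_S (INR k + nu + 1)) by lra. simpl. field.
repeat split; try lra. apply pow_nonzero. lra.
Qed.

Lemma CV_radius_bessel_coef (nu : R) : -1 < nu -> CV_radius (bessel_coef nu) = p_infty.
Proof.
intros hnu. apply CV_radius_infinite_DAlembert.
- intros k. now apply bessel_coef_neq_0.
- apply is_lim_seq_le_le with (fun _ => 0) (fun k => / (nu + 1) * / INR (S k)).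
  + intros k. split; [apply Rabs_pos |].
    rewrite bessel_coef_S by easy. pose proof (pos_INR k).
    replace (- bessel_coef nu k / (4 * (INR k + 1) * (INR k + nu + 1)) / bessel_coef nu k)
      with (- / (4 * (INR k + 1) * (INR k + nu + 1)))
      by (field; repeat split; try lra; now apply bessel_coef_neq_0).
    rewrite Rabs_Ropp, S_INR, <- Rinv_mult.
    rewrite Rabs_right by (apply Rle_ge, Rlt_le, Rinv_0_lt_compat; nra).
    apply Rinv_le_contravar; nra.
  + apply is_lim_seq_const.
  + replace (Finite 0) with (Rbar_mult (/ (nu + 1)) (Finite 0)) by (simpl; f_equal; ring).
    apply is_lim_seq_scal_l. apply (is_lim_seq_incr_1 (fun k => / INR k)).
    apply (is_lim_seq_inv INR p_infty); [apply is_lim_seq_INR | easy].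
Qed.

Definition bessel_phi (nu : R) : R -> R := PSeries (bessel_coef nu).
Definition bessel_phi1 (nu : R) : R -> R := PSeries (PS_derive (bessel_coef nu)).
Definition bessel_phi2 (nu : R) : R -> R := PSeries (PS_derive (PS_derive (bessel_coef nu))).

Lemma is_derive_bessel_phi (nu y : R) : -1 < nu ->
  is_derive (bessel_phi nu) y (bessel_phi1 nu y).
Proof. intros hnu. apply is_derive_PSeries. now rewrite CV_radius_bessel_coef. Qed.

Lemma is_derive_bessel_phi1 (nu y : R) : -1 < nu ->
  is_derive (bessel_phi1 nu) y (bessel_phi2 nu y).
Proof.
intros hnu. apply is_derive_PSeries. now rewrite CV_radius_derive, CV_radius_bessel_coef.
Qed.

(** This is Bessel's equation in the variable y = x^2; comparing coefficients of y^k reduces it to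
    the recurrence [bessel_coef_S]. *)
Lemma bessel_phi_ode (nu y : R) : -1 < nu ->
  4 * y * bessel_phi2 nu y + 4 * (nu + 1) * bessel_phi1 nu y + bessel_phi nu y = 0.
Proof.
intros hnu. unfold bessel_phi, bessel_phi1, bessel_phi2.
assert (h0 : ex_pseries (bessel_coef nu) y)
  by (apply CV_radius_inside; now rewrite CV_radius_bessel_coef).
assert (h1 : ex_pseries (PS_derive (bessel_coef nu)) y)
  by (apply CV_radius_inside; now rewrite CV_radius_derive, CV_radius_bessel_coef).
assert (h2 : ex_pseries (PS_derive (PS_derive (bessel_coef nu))) y)
  by (apply CV_radius_inside; now rewrite !CV_radius_derive, CV_radius_bessel_coef).
rewrite Rmult_assoc, <- PSeries_incr_1, <- !PSeries_scal.
rewrite <- !PSeries_plus.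
- rewrite <- (PSeries_const_0 y). apply PSeries_ext. intros k.
  unfold PS_plus, PS_scal, PS_incr_1, PS_derive, plus, scal, mult; cbn -[INR bessel_coef];
  unfold mult; cbn -[INR bessel_coef].
  (* The shifted series has constant coefficient zero, so k = 0 is separate. *)
  destruct k as [| k].
  + rewrite bessel_coef_S by easy. simpl. unfold zero; simpl. field. lra.
  + rewrite bessel_coef_S with (k := S k) by easy. rewrite !S_INR.
    pose proof (pos_INR k). field. lra.
- apply ex_pseries_plus.
  + apply ex_pseries_scal; [apply Rmult_comm |]. now apply ex_pseries_incr_1.
  + apply ex_pseries_scal; [apply Rmult_comm | easy].
- easy.
- apply ex_pseries_scal; [apply Rmult_comm |]. now apply ex_pseries_incr_1.
- apply ex_pseries_scal; [apply Rmult_comm | easy].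
Qed.

Lemma bessel_phi_0_pos (nu : R) : -1 < nu -> 0 < bessel_phi nu 0.
Proof.
intros hnu. unfold bessel_phi. rewrite PSeries_0. unfold bessel_coef. simpl.
rewrite !Rplus_0_l.
pose proof (Gamma_pos 1 ltac:(lra)). pose proof (Gamma_pos (nu + 1) ltac:(lra)).
rewrite Rdiv_1_r. apply Rdiv_lt_0_compat; [lra | nra].
Qed.

Lemma bessel_J_phi (nu x : R) : 0 < x ->
  bessel_J nu x = Rpower (x / 2) nu * bessel_phi nu (x ^ 2).
Proof.
intros hx. unfold bessel_J, bessel_phi, PSeries. rewrite <- Series_scal_l.
apply Series_ext. intros k. unfold bessel_coef.
rewrite Rpower_plus.
replace (2 * INR k) with (INR (2 * k)) by (rewrite mult_INR; simpl; ring).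
rewrite Rpower_pow by lra.
rewrite pow_mult. replace ((x / 2) ^ 2) with (x ^ 2 * / 4) by field.
rewrite Rpow_mult_distr, pow_inv. unfold Rdiv. ring.
Qed.

(** * The Riccati-Bessel functions *)

Definition half_nu (n : nat) : R := INR n + 1 / 2.

Lemma half_nu_gt (n : nat) : -1 < half_nu n.
Proof. unfold half_nu. pose proof (pos_INR n). lra. Qed.

Definition ric_series (n : nat) (x : R) : R := bessel_phi (half_nu n) (x ^ 2).

(** This is x^(-2n) (x^(2n+1) A)' with A = [ric_series n]. By the classical rule (x^nu J_nu)' = x^nu
    J_(nu-1) it represents the order n - 1/2, using only the series of order n + 1/2. *)
Definition ric_pred_series (n : nat) (x : R) : R :=
  (2 * INR n + 1) * ric_series n x + 2 * x ^ 2 * bessel_phi1 (half_nu n) (x ^ 2).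

(* Up to a common positive factor, [x j_n(x)] and [x j_(n-1)(x)] for the
   spherical Bessel functions [j_n]. *)
Definition ric (n : nat) (x : R) : R := x ^ n * x * ric_series n x.

Definition ric_pred (n : nat) (x : R) : R := x ^ n * ric_pred_series n x.

Lemma is_derive_ric_series (n : nat) (x : R) :
  is_derive (ric_series n) x (2 * x * bessel_phi1 (half_nu n) (x ^ 2)).
Proof.
unfold ric_series. pose proof (is_derive_bessel_phi (half_nu n) (x ^ 2) (half_nu_gt n)) as h.
auto_derive.
- eexists. exact h.
- replace (x * (x * 1)) with (x ^ 2) by ring.
  rewrite (is_derive_unique (fun y : R => bessel_phi (half_nu n) y) _ _ h). ring.
Qed.

(** Bessel's equation enters here; it closes the first-order system for [ric] and [ric_pred]. *)
Lemma is_derive_ric_pred_series (n : nat) (x : R) : is_derive (ric_pred_series n) x (- x * ric_series n x).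
Proof.
pose proof (is_derive_ric_series n x) as hA.
pose proof (is_derive_bessel_phi1 (half_nu n) (x ^ 2) (half_nu_gt n)) as h1.
pose proof (bessel_phi_ode (half_nu n) (x ^ 2) (half_nu_gt n)) as ode.
unfold ric_pred_series. auto_derive.
- repeat split; [eexists; exact hA | eexists; exact h1].
- replace (x * (x * 1)) with (x ^ 2) by ring.
  rewrite (is_derive_unique (fun y : R => bessel_phi1 (half_nu n) y) _ _ h1).
  rewrite (is_derive_unique (fun y : R => ric_series n y) _ _ hA).
  replace (ric_series n x) with
    (- (4 * x ^ 2 * bessel_phi2 (half_nu n) (x ^ 2)
        + 4 * (half_nu n + 1) * bessel_phi1 (half_nu n) (x ^ 2)))
    by (unfold ric_series; lra).
  generalize (bessel_phi1 (half_nu n) (x ^ 2)) (bessel_phi2 (half_nu n) (x ^ 2)).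
  intros y1 y2. unfold half_nu. field.
Qed.

Lemma is_derive_pow_ratio (n : nat) (x : R) : 0 < x ->
  is_derive (fun t => t ^ n) x (INR n * x ^ n / x).
Proof.
intros hx. auto_derive; [easy |].
destruct n as [| n]; [simpl; field; lra |]. simpl pred. simpl pow. field. lra.
Qed.

Lemma is_derive_ric (n : nat) (x : R) : 0 < x ->
  is_derive (ric n) x (ric_pred n x - INR n / x * ric n x).
Proof.
intros hx. pose proof (is_derive_ric_series n x) as hA.
pose proof (is_derive_pow_ratio n x hx) as hp.
unfold ric at 1.
evar_last.
{ apply (is_derive_mult (fun t => t ^ n * t) (ric_series n)); [| exact hA | exact Rmult_comm].
  apply (is_derive_mult (fun t => t ^ n) (fun t => t)); [exact hp | apply is_derive_id | exact Rmult_comm]. }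
unfold plus, mult, one; simpl. change (x * (x * 1)) with (x ^ 2). unfold ric, ric_pred, ric_pred_series. field. lra.
Qed.

Lemma is_derive_ric_pred (n : nat) (x : R) : 0 < x ->
  is_derive (ric_pred n) x (INR n / x * ric_pred n x - ric n x).
Proof.
intros hx.
unfold ric_pred at 1.
evar_last.
{ apply (is_derive_mult (fun t => t ^ n) (ric_pred_series n));
    [now apply is_derive_pow_ratio | apply is_derive_ric_pred_series | exact Rmult_comm]. }
unfold plus, mult; simpl. unfold ric, ric_pred. field. lra.
Qed.

Lemma continuous_of_is_derive (f : R -> R) (x l : R) : is_derive f x l -> continuous f x.
Proof. intros h. apply (@ex_derive_continuous R_AbsRing R_NormedModule). now exists l. Qed.

Ltac solve_continuous_series :=
  apply (@ex_derive_continuous R_AbsRing R_NormedModule);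
  auto_derive; repeat split;
  lazymatch goal with
  | |- ex_derive (fun y => ric_series _ y) _ => eexists; apply is_derive_ric_series
  | |- ex_derive (fun y => ric_pred_series _ y) _ => eexists; apply is_derive_ric_pred_series
  end.

Lemma ric_series_0_pos (n : nat) : 0 < ric_series n 0.
Proof.
unfold ric_series. replace (0 ^ 2) with 0 by ring. apply bessel_phi_0_pos, half_nu_gt.
Qed.

Lemma ric_pred_series_0 (n : nat) : ric_pred_series n 0 = (2 * INR n + 1) * ric_series n 0.
Proof. unfold ric_pred_series. ring. Qed.

Lemma ric_pos_near_0 (n : nat) :
  exists d, 0 < d /\ forall x, 0 < x < d -> 0 < ric n x.
Proof.
destruct (pos_near_0 (ric_series n)) as [d [hd h]].
- eapply continuous_of_is_derive, is_derive_ric_series.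
- apply ric_series_0_pos.
- exists d. split; [easy |]. intros x hx. unfold ric.
  pose proof (pow_lt x n (proj1 hx)). pose proof (h x hx).
  apply Rmult_lt_0_compat; nra.
Qed.

(** * The Turán expression and the quadratic form behind V *)

(** Up to a positive constant this is x^2 (j_(n-1)^2 - j_n j_(n-2)), with j_(n-2) eliminated by
    j_(n-2) = ((2n-1)/x) j_(n-1) - j_n. *)
Definition turan (n : nat) (x : R) : R :=
  ric_pred n x ^ 2 + ric n x ^ 2 - (2 * INR n - 1) / x * (ric n x * ric_pred n x).

(* [x turan] is nondecreasing because its derivative is [2 ric_pred ^ 2]. *)
Lemma turan_pos (n : nat) (x : R) : 0 < x -> 0 < turan n x.
Proof.
intros hx.
assert (0 < x * turan n x); [| nra].
revert x hx.
(* This is x [turan] divided by x^(2n+1), which is continuous at 0. *)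
destruct (pos_near_0 (fun x => ric_pred_series n x ^ 2 + x ^ 2 * ric_series n x ^ 2 - (2 * INR n - 1) * (ric_series n x * ric_pred_series n x)))
  as [d [hd h]].
- solve_continuous_series.
- rewrite ric_pred_series_0. pose proof (ric_series_0_pos n). pose proof (pos_INR n).
  replace (_ - _) with (2 * (2 * INR n + 1) * ric_series n 0 ^ 2) by ring.
  apply Rmult_lt_0_compat; nra.
- apply (pos_of_pos_near_0 _ (fun x => 2 * ric_pred n x ^ 2) d hd).
  + intros x hx. specialize (h x hx). cbv beta in h.
    pose proof (pow_lt x n (proj1 hx)).
    replace (x * turan n x) with (x ^ n * x ^ n * x *
      (ric_pred_series n x ^ 2 + x ^ 2 * ric_series n x ^ 2 - (2 * INR n - 1) * (ric_series n x * ric_pred_series n x)))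
      by (unfold turan, ric, ric_pred; field; lra).
    repeat apply Rmult_lt_0_compat; lra.
  + intros x hx. pose proof (is_derive_ric n x hx) as hu.
    pose proof (is_derive_ric_pred n x hx) as hb.
    unfold turan. auto_derive.
    * repeat split; try (eexists; eassumption). lra.
    * rewrite (is_derive_unique (fun y : R => ric n y) _ _ hu).
      rewrite (is_derive_unique (fun y : R => ric_pred n y) _ _ hb). field. lra.
  + intros x hx. pose proof (pow2_ge_0 (ric_pred n x)). lra.
Qed.

(* [V (f_ n)] divided by [x ^ (2 n)], up to a positive constant. *)
Definition V_red (n : nat) (x : R) : R :=
  ric_pred n x ^ 2 * (1 + (2 * INR n - INR n ^ 2) / x ^ 2)
  + ric n x * ric_pred n x
    * (- 2 * INR n / x + INR n * (INR n - 1) * (2 * INR n - 1) / x ^ 3)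
  + ric n x ^ 2 * (1 - INR n * (INR n - 1) / x ^ 2).

Lemma is_derive_V_red (n : nat) (x : R) : 0 < x ->
  is_derive (V_red n) x (3 * INR n * (INR n - 1) / x ^ 3 * turan n x).
Proof.
intros hx. pose proof (is_derive_ric n x hx) as hu.
pose proof (is_derive_ric_pred n x hx) as hb.
unfold V_red, turan. auto_derive.
- repeat split; try (eexists; eassumption); simpl; try nra.
  apply Rgt_not_eq. repeat apply Rmult_lt_0_compat; lra.
- rewrite (is_derive_unique (fun y : R => ric n y) _ _ hu).
  rewrite (is_derive_unique (fun y : R => ric_pred n y) _ _ hb). field. lra.
Qed.

(** For n >= 1 the factor n(n-1) is nonnegative; at n = 1 it vanishes and [V_red] is constant, so
    monotonicity can only be weak. *)
Lemma derive_V_red_nonneg (n : nat) (x : R) : (1 <= n)%nat -> 0 < x ->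
  0 <= 3 * INR n * (INR n - 1) / x ^ 3 * turan n x.
Proof.
intros hn hx. apply le_INR in hn. simpl in hn.
apply Rmult_le_pos; [| now apply Rlt_le, turan_pos].
apply Rdiv_le_0_compat; [nra | now apply pow_lt].
Qed.

Lemma V_red_pos (n : nat) (x : R) : (1 <= n)%nat -> 0 < x -> 0 < V_red n x.
Proof.
intros hn. revert x.
(* This is [V_red] divided by x^(2n-2), again continuous at 0. *)
destruct (pos_near_0 (fun x =>
    ric_pred_series n x ^ 2 * (x ^ 2 + 2 * INR n - INR n ^ 2)
    + ric_series n x * ric_pred_series n x * (- 2 * INR n * x ^ 2 + INR n * (INR n - 1) * (2 * INR n - 1))
    + ric_series n x ^ 2 * x ^ 2 * (x ^ 2 - INR n * (INR n - 1)))) as [d [hd h]].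
- solve_continuous_series.
- rewrite ric_pred_series_0. pose proof (ric_series_0_pos n). apply le_INR in hn. simpl in hn.
  replace (_ + _) with (3 * INR n * (2 * INR n + 1) * ric_series n 0 ^ 2) by ring.
  apply Rmult_lt_0_compat; nra.
- apply (pos_of_pos_near_0 _ _ d hd) with (2 := is_derive_V_red n).
  + intros x hx. specialize (h x hx). cbv beta in h.
    (* With n = m + 1 the factor x^(2n-2) is x^m x^m, free of truncated subtraction. *)
    destruct n as [| m]; [lia |].
    pose proof (pow_lt x m (proj1 hx)).
    apply Rlt_le_trans with (x ^ m * x ^ m *
      (ric_pred_series (S m) x ^ 2 * (x ^ 2 + 2 * INR (S m) - INR (S m) ^ 2)
    + ric_series (S m) x * ric_pred_series (S m) x * (- 2 * INR (S m) * x ^ 2 + INR (S m) * (INR (S m) - 1) * (2 * INR (S m) - 1))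
    + ric_series (S m) x ^ 2 * x ^ 2 * (x ^ 2 - INR (S m) * (INR (S m) - 1)))).
    * repeat apply Rmult_lt_0_compat; lra.
    * apply Req_le. unfold V_red, ric, ric_pred. rewrite <- !tech_pow_Rmult. field. lra.
  + intros x hx. now apply derive_V_red_nonneg.
Qed.

(** * Derivatives of f_n and p, and the closed form of V(f_n) *)

Definition f_scale (n : nat) : R := sqrt (PI / 2) * Rpower (/ 2) (half_nu n).

Lemma f_scale_pos (n : nat) : 0 < f_scale n.
Proof.
apply Rmult_lt_0_compat; [| apply Rpower_pos].
apply sqrt_lt_R0. pose proof PI_RGT_0. lra.
Qed.

Lemma bessel_J_ric (n : nat) (x : R) : 0 < x ->
  bessel_J (half_nu n) x = Rpower (/ 2) (half_nu n) * (Rpower x (- 1 / 2) * ric n x).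
Proof.
intros hx. rewrite bessel_J_phi by easy. change (x / 2) with (x * / 2).
rewrite <- Rpower_mult_distr by lra.
replace (half_nu n) with (- 1 / 2 + (INR n + 1)) at 1 by (unfold half_nu; field).
rewrite !Rpower_plus, Rpower_pow, Rpower_1 by easy. unfold ric, ric_series. ring.
Qed.

Lemma f_ric (n : nat) (x : R) : 0 < x -> f_ n x = f_scale n * (x ^ n * ric n x).
Proof.
intros hx. unfold f_. fold (half_nu n). rewrite bessel_J_ric by easy.
replace (x ^ n) with (Rpower x (half_nu n) * Rpower x (- 1 / 2)).
- unfold f_scale. ring.
- rewrite <- Rpower_plus, <- Rpower_pow by easy. f_equal. unfold half_nu. field.
Qed.

(** Closed forms of the derivatives are known only on the half-line; as it is open, they can still
    be differentiated, one order at a time. *)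
Lemma Derive_n_S_pos (f g dg : R -> R) (k : nat) :
  (forall t, 0 < t -> Derive_n f k t = g t) ->
  (forall t, 0 < t -> is_derive g t (dg t)) ->
  forall t, 0 < t -> Derive_n f (S k) t = dg t.
Proof.
intros hf hg t ht. simpl. rewrite (Derive_ext_loc _ g).
- now apply is_derive_unique, hg.
- eapply filter_imp; [exact hf | now apply locally_Rlt].
Qed.

(** The weight x^n cancels the term -(n/x) [ric] in the derivative of [ric] and doubles (n/x)
    [ric_pred] in that of [ric_pred]. *)
Lemma Derive_f_ (n : nat) (x : R) : 0 < x ->
  Derive (f_ n) x = f_scale n * (x ^ n * ric_pred n x) /\
  Derive_n (f_ n) 2 x = f_scale n * (x ^ n * (2 * INR n / x * ric_pred n x - ric n x)).
Proof.
assert (h1 : forall t, 0 < t ->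
  Derive_n (f_ n) 1 t = f_scale n * (t ^ n * ric_pred n t)).
{ apply (Derive_n_S_pos _ (fun t => f_scale n * (t ^ n * ric n t))).
  - now apply f_ric.
  - intros t ht. apply (is_derive_scal (fun t => t ^ n * ric n t)).
    evar_last.
    { apply (is_derive_mult (fun t => t ^ n) (ric n));
        [now apply is_derive_pow_ratio | now apply is_derive_ric | exact Rmult_comm]. }
    unfold plus, mult; simpl. field. lra. }
intros hx. split; [now apply h1 |]. revert x hx.
apply (Derive_n_S_pos _ _ _ _ h1).
intros t ht. apply (is_derive_scal (fun t => t ^ n * ric_pred n t)).
evar_last.
{ apply (is_derive_mult (fun t => t ^ n) (ric_pred n));
    [now apply is_derive_pow_ratio | now apply is_derive_ric_pred | exact Rmult_comm]. }
unfold plus, mult; simpl. field. lra.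
Qed.

Lemma Derive_p_ (n : nat) (x : R) : 0 < x ->
  Derive (p_ n) x = 2 * INR n / x ^ 2 /\
  Derive_n (p_ n) 2 x = - 4 * INR n / x ^ 3 /\
  Derive_n (p_ n) 3 x = 12 * INR n / x ^ 4.
Proof.
assert (h1 : forall t, 0 < t -> Derive_n (p_ n) 1 t = 2 * INR n / t ^ 2).
{ apply (Derive_n_S_pos _ (p_ n)); [easy |].
  intros t ht. unfold p_. auto_derive; [lra | field; lra]. }
assert (h2 : forall t, 0 < t -> Derive_n (p_ n) 2 t = - 4 * INR n / t ^ 3).
{ apply (Derive_n_S_pos _ _ _ _ h1).
  intros t ht. auto_derive; [nra | field; lra]. }
intros hx. split; [now apply h1 | split; [now apply h2 |]]. revert x hx.
apply (Derive_n_S_pos _ _ _ _ h2).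
intros t ht. auto_derive; [| field; lra].
apply Rgt_not_eq. repeat apply Rmult_lt_0_compat; lra.
Qed.

(** The terms p'''/p' - (3/2)(p''/p')^2 form the Schwarzian derivative of p, which vanishes because
    p is a Möbius function. The coefficient of v is then 2 - 2n(n-1)/x^2. *)
Lemma V_f_ (n : nat) (x : R) : (1 <= n)%nat -> 0 < x ->
  V (p_ n) q_ (f_ n) x = x ^ (2 * n) * (2 * f_scale n ^ 2 * V_red n x).
Proof.
intros hn hx. apply le_INR in hn. simpl in hn.
destruct (Derive_f_ n x hx) as [hf1 hf2].
destruct (Derive_p_ n x hx) as (hp1 & hp2 & hp3).
unfold V, v, q_. rewrite hf1, hf2, hp1, hp2, hp3, f_ric by easy.
unfold p_, V_red. replace (2 * n)%nat with (n + n)%nat by lia. rewrite pow_add.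
(* [V] divides by p' = 2n/x^2, which is nonzero because n >= 1. *)
field. split; lra.
Qed.

(** * The first positive zero of the derivative of J_(n+1/2) *)

(* [J_(n+1/2)'] up to a positive factor. *)
Definition dJ_red (n : nat) (x : R) : R := ric_pred n x - half_nu n / x * ric n x.

Lemma is_derive_bessel_J_red (n : nat) (x : R) : 0 < x ->
  is_derive (fun t => Rpower t (- 1 / 2) * ric n t) x (Rpower x (- 1 / 2) * dJ_red n x).
Proof.
intros hx. evar_last.
{ apply (is_derive_mult (fun t => Rpower t (- 1 / 2)) (ric n));
    [now apply is_derive_Rpower | now apply is_derive_ric | exact Rmult_comm]. }
unfold plus, mult; simpl. unfold dJ_red, half_nu. field. lra.
Qed.

Lemma Derive_bessel_J (n : nat) (x : R) : 0 < x ->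
  Derive (bessel_J (half_nu n)) x
  = Rpower (/ 2) (half_nu n) * Rpower x (- 1 / 2) * dJ_red n x.
Proof.
intros hx.
rewrite (Derive_ext_loc _ (fun t => Rpower (/ 2) (half_nu n) * (Rpower t (- 1 / 2) * ric n t))).
- apply is_derive_unique. rewrite Rmult_assoc.
  apply (is_derive_scal (fun t => Rpower t (- 1 / 2) * ric n t)).
  now apply is_derive_bessel_J_red.
- eapply filter_imp; [| now apply locally_Rlt]. intros t ht. now apply bessel_J_ric.
Qed.

Lemma dJ_red_pos_near_0 (n : nat) :
  exists d, 0 < d /\ forall x, 0 < x < d -> 0 < dJ_red n x.
Proof.
(* This is [dJ_red] divided by x^n; its value at 0 is (n + 1/2) [ric_series n 0]. *)
destruct (pos_near_0 (fun x => ric_pred_series n x - half_nu n * ric_series n x)) as [d [hd h]].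
- solve_continuous_series.
- rewrite ric_pred_series_0. pose proof (ric_series_0_pos n). pose proof (pos_INR n). unfold half_nu. nra.
- exists d. split; [easy |]. intros x hx. specialize (h x hx). cbv beta in h.
  pose proof (pow_lt x n (proj1 hx)).
  replace (dJ_red n x) with (x ^ n * (ric_pred_series n x - half_nu n * ric_series n x))
    by (unfold dJ_red, ric, ric_pred; field; lra).
  now apply Rmult_lt_0_compat.
Qed.

(* If [J'] stayed positive, [ric] would be positive and increasing, whereas
   [ric'' = (n (n + 1) / x ^ 2 - 1) ric] forces [ric'] to become negative. *)
Lemma dJ_red_nonpos (n : nat) : exists x, 0 < x /\ dJ_red n x <= 0.
Proof.
apply NNPP. intros hno.
assert (hd : forall x, 0 < x -> 0 < dJ_red n x).
{ intros x hx. apply Rnot_le_lt. intros hle. apply hno. now exists x. }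
clear hno. pose proof (pos_INR n) as hn.
assert (hu : forall x, 0 < x -> 0 < ric n x).
{ intros x hx. destruct (ric_pos_near_0 n) as [d [hd0 h]].
  assert (0 < Rpower x (- 1 / 2) * ric n x).
  - revert x hx. apply (pos_of_pos_near_0 _ _ d hd0) with (2 := is_derive_bessel_J_red n).
    + intros x hx. apply Rmult_lt_0_compat; [apply Rpower_pos | now apply h].
    + intros x hx. apply Rlt_le, Rmult_lt_0_compat; [apply Rpower_pos | now apply hd].
  - pose proof (Rpower_pos x (- 1 / 2)). nra. }
(* [w] is the derivative of [ric]. *)
set (w := fun x => ric_pred n x - INR n / x * ric n x).
assert (hw : forall x, 0 < x -> 0 < w x).
{ intros x hx. unfold w.
  replace (_ - _) with (dJ_red n x + ric n x / (2 * x))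
    by (unfold dJ_red, half_nu; field; lra).
  apply Rplus_lt_0_compat; [now apply hd |].
  apply Rdiv_lt_0_compat; [now apply hu | lra]. }
assert (hinc : forall x y, 0 < x -> x <= y -> ric n x <= ric n y).
{ apply (nondecreasing_of_derive_nonneg _ w).
  - intros x hx. now apply is_derive_ric.
  - intros x hx. now apply Rlt_le, hw. }
set (dw := fun x => (INR n * (INR n + 1) / x ^ 2 - 1) * ric n x).
assert (hdw : forall x, 0 < x -> is_derive w x (dw x)).
{ intros x hx. pose proof (is_derive_ric n x hx) as h1.
  pose proof (is_derive_ric_pred n x hx) as h2.
  unfold w, dw. auto_derive.
  - repeat split; try (eexists; eassumption). lra.
  - rewrite (is_derive_unique (fun y : R => ric n y) _ _ h1).
    rewrite (is_derive_unique (fun y : R => ric_pred n y) _ _ h2). field. lra. }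
(* From [X] on, n(n+1)/x^2 is below 1/2, so [dw] is at most minus half of [ric]. *)
set (X := 2 * INR n + 2).
pose proof (hu X ltac:(unfold X; lra)) as huX.
pose proof (hw X ltac:(unfold X; lra)) as hwX.
(* The line of slope [- ric n X / 2] through (X, w X) reaches zero at [Y], contradicting w Y > 0. *)
set (Y := X + 2 * w X / ric n X).
assert (hXY : X < Y).
{ assert (0 < 2 * w X / ric n X) by (apply Rdiv_lt_0_compat; lra). unfold Y. lra. }
assert (hX : 0 < X) by (unfold X; lra).
destruct (MVT_gen w X Y dw) as [c [hc e]]; rewrite ?Rmin_left, ?Rmax_right in * by lra.
- intros t ht. apply hdw. lra.
- intros t ht. apply continuity_pt_filterlim. apply (continuous_of_is_derive _ _ (dw t)).
  apply hdw. lra.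
- pose proof (hw Y ltac:(lra)).
  pose proof (hinc X c hX (proj1 hc)).
  assert (hcoef : INR n * (INR n + 1) / c ^ 2 - 1 <= - / 2).
  { assert (INR n * (INR n + 1) / c ^ 2 <= / 2); [| lra].
    apply Rmult_le_reg_r with (c ^ 2); [apply pow_lt; lra |].
    unfold Rdiv. rewrite Rmult_assoc, Rinv_l by (apply pow_nonzero; lra).
    assert (X ^ 2 <= c ^ 2) by (apply pow_incr; lra).
    unfold X in *. nra. }
  assert (hdc : dw c <= - (ric n X / 2)).
  { unfold dw. nra. }
  assert (dw c * (Y - X) <= - (ric n X / 2) * (Y - X)) by (apply Rmult_le_compat_r; lra).
  assert (ric n X / 2 * (Y - X) = w X) by (unfold Y; field; lra).
  lra.
Qed.

Lemma bessel_J'_first_zero (n : nat) :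
  exists j, is_first_positive_zero (Derive (bessel_J (half_nu n))) j.
Proof.
destruct (dJ_red_pos_near_0 n) as [d [hd hp]].
destruct (dJ_red_nonpos n) as [x0 [hx0 hle]].
destruct (first_positive_zero_exists (dJ_red n) d x0) as (j & hj & hz & hnz); try easy.
- intros x hx. pose proof (is_derive_ric n x hx) as h1.
  pose proof (is_derive_ric_pred n x hx) as h2.
  unfold dJ_red. apply (@ex_derive_continuous R_AbsRing R_NormedModule).
  auto_derive. repeat split; try (eexists; eassumption). lra.
- exists j. split; [easy | split].
  + rewrite Derive_bessel_J, hz by easy. ring.
  + intros x hx. rewrite Derive_bessel_J by easy.
    specialize (hnz x hx). pose proof (Rpower_pos x (- 1 / 2)).
    pose proof (Rpower_pos (/ 2) (half_nu n)).
    repeat apply Rmult_integral_contrapositive_currified; lra.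
Qed.

Theorem corollary20 (n : nat) (hn : (1 <= n)%nat) :
  (forall x : R, 0 < x -> 0 < V (p_ n) q_ (f_ n) x) /\
  exists j : R,
    is_first_positive_zero (Derive (bessel_J (INR n + 1 / 2))) j /\
    increasing_on 0 j (fun x => V (p_ n) q_ (f_ n) x / x ^ (2 * n)) /\
    positive_on 0 j (fun x => V (p_ n) q_ (f_ n) x / x ^ (2 * n)) /\
    increasing_on 0 j (V (p_ n) q_ (f_ n)) /\
    positive_on 0 j (V (p_ n) q_ (f_ n)).
Proof.
set (g := fun x => 2 * f_scale n ^ 2 * V_red n x).
pose proof (f_scale_pos n) as hk.
assert (hk2 : 0 < 2 * f_scale n ^ 2) by nra.
assert (hg : forall x, 0 < x -> 0 < g x).
{ intros x hx. apply Rmult_lt_0_compat; [easy | now apply V_red_pos]. }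
assert (hgi : forall x y, 0 < x -> x <= y -> g x <= g y).
{ intros x y hx hxy. apply Rmult_le_compat_l; [lra |].
  apply (nondecreasing_of_derive_nonneg _ _ (is_derive_V_red n)); try easy.
  intros t ht. now apply derive_V_red_nonneg. }
assert (hV : forall x, 0 < x -> V (p_ n) q_ (f_ n) x = x ^ (2 * n) * g x)
  by (intros x hx; now apply V_f_).
assert (hVr : forall x, 0 < x -> V (p_ n) q_ (f_ n) x / x ^ (2 * n) = g x).
{ intros x hx. rewrite hV by easy. field. apply pow_nonzero. lra. }
assert (hVp : forall x, 0 < x -> 0 < V (p_ n) q_ (f_ n) x).
{ intros x hx. rewrite hV by easy.
  apply Rmult_lt_0_compat; [now apply pow_lt | now apply hg]. }
split; [easy |].
destruct (bessel_J'_first_zero n) as [j hj].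
exists j. split; [easy |]. repeat split.
- intros x y hx hxy _. rewrite !hVr by lra. apply hgi; lra.
- intros x hx. rewrite hVr by easy. now apply hg.
(* [V] is a product of two nonnegative nondecreasing factors, x^(2n) and [g]. *)
- intros x y hx hxy _. rewrite !hV by lra.
  apply Rmult_le_compat.
  + apply pow_le. lra.
  + apply Rlt_le, hg. lra.
  + apply pow_incr. lra.
  + apply hgi; lra.
- intros x hx. now apply hVp.
Qed.
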